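(* There exist constants $\delta_1,\delta_2,\delta_3>0$ such that the following holds. For any positive integers $n,d$ and any $(n,d,\lambda)$-graph $G$ such that $d\le\delta_3 n$ and $\lambda/d\le\delta_1$, $$\mu(G)\ge \exp\left(\frac{\delta_2 n\log d}{d}\right).$$
   Context: Graphs are finite and simple. Given a $d$-regular graph $G$ on $n$ vertices, let $d=\lambda_1\ge \lambda_2\ge\cdots\ge\lambda_n$ be the eigenvalues of its adjacency matrix (with multiplicity) and let $\lambda=\max\{|\lambda_2|,|\lambda_n|\}$; then $G$ is called an $(n,d,\lambda)$-graph. For a graph $G$, $\mu(G)$ denotes the number of non-isomorphic induced subgraphs of $G$, that is, the number of isomorphism classes of graphs of the form $G[S]$ with $S\subseteq V(G)$. *)

(* Defs.v *)
From mathcomp Require Import all_boot all_order all_algebra.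
From mathcomp Require Import all_classical all_reals all_analysis.

Set Implicit Arguments.
Unset Strict Implicit.
Unset Printing Implicit Defensive.

Import Order.TTheory GRing.Theory Num.Theory.
Local Open Scope ring_scope.

Record sgraph := SGraph {
  vertex :> finType;
  adj : rel vertex;
  adj_sym : symmetric adj;
  adj_irr : irreflexive adj
}.

Definition regular (G : sgraph) (d : nat) : Prop :=
  forall x : G, #|[set y : G | adj x y]| = d.

Section Induced.
Variables (G : sgraph) (S : {set G}).

Definition induced_adj : rel {x : G | x \in S} :=
  fun u v => adj (val u) (val v).

Lemma induced_adj_sym : symmetric induced_adj.
Proof. by move=> u v; exact: adj_sym. Qed.

Lemma induced_adj_irr : irreflexive induced_adj.
Proof. by move=> u; exact: adj_irr. Qed.

Definition induced : sgraph := SGraph induced_adj_sym induced_adj_irr.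
End Induced.

Definition graph_iso (G H : sgraph) : Prop :=
  exists2 f : G -> H, bijective f & forall x y, adj (f x) (f y) = adj x y.

(* The blocks of this partition of the subsets S of V(G) are the isomorphism
   classes of the graphs G[S]; the empty S is included. *)
Definition num_induced (G : sgraph) : nat :=
  #|equivalence_partition
      (fun S1 S2 : {set G} => `[< graph_iso (induced S1) (induced S2) >])
      [set: {set G}]|.

Definition adjmx (R : realType) (G : sgraph) : 'M[R]_#|G| :=
  \matrix_(i, j) (adj (enum_val i) (enum_val j))%:R.

(* s lists the eigenvalues of A in nonincreasing order, with multiplicity.
   Every real symmetric A has exactly one such s. *)
Definition spectrum (R : realType) (m : nat) (A : 'M[R]_m) (s : seq R) : Prop :=
  sorted (fun x y => y <= x) s /\ char_poly A = \prod_(x <- s) ('X - x%:P).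

(* Sequences are numbered from 0, so lambda_2 is s`_1 and lambda_n is s`_n.-1;
   for d > 0 we have n >= 2 and both indices are in range. *)
Definition ndl_graph (R : realType) (n d : nat) (lam : R) (G : sgraph) : Prop :=
  [/\ #|G| = n, regular G d &
      exists2 s : seq R, spectrum (adjmx R G) s &
        lam = Num.max `|s`_1| `|s`_n.-1| ].

(* Main.v *)
Require Import Defs.
From mathcomp Require Import all_boot all_order all_algebra.
From mathcomp Require Import all_classical all_reals all_analysis.
From mathcomp Require Import complex ring lra zify.
From mathcomp Require Import fintype finset.
Require Import Defs.

(** Why the theorem holds.  Fix a vertex set U, and sort the vertices w outside
    U by their trace on U, the set N(w) :&: U.  Let W' be a set of vertices
    outside U.  An isomorphism from G[U :|: W'] to a fixed representative of its
    class restricts to a homomorphism phi from U to G, and the class together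
    with phi determines, for each subset p of U, how many vertices of W' have
    trace p.  If W is disjoint from U and contains m_p vertices of trace p, these
    counts can be prescribed freely between 0 and m_p, so that
      prod_p (m_p + 1) <= mu(G) * #(homomorphisms from U to G)
    ([prod_profiles_le]).  If U is built by adding vertices one at a time, each
    adjacent to a previous one, there are at most n d^|U| homomorphisms.

    Hence it is enough to find such a U with |U| = O(n/d) for which a fixed
    proportion of the vertices lie in trace classes of at most M = d/K vertices,
    where K is a large constant.  Indeed x |-> log (1 + x) / x decreases, so
    these classes alone make the product at least (M+1)^(|W|/M), which is at
    least exp (c K n log d / d) for an absolute constant c > 0 and beats
    n d^|U| = exp (O (n log d / d)) once K is large.

    The set U ([separating_set]) maximises
      16 (|N(U)| + #separated vertices) - d |U|,
    where N(U) consists of the vertices with a neighbour in U, and a vertex of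
    N(U) is separated when its class has at most M elements.
    Maximality bounds |U| at once.  If N(U) were less than half of G, then edges
    would be spread so evenly that some vertex of N(U) sends d/4 edges out of
    N(U) ([expanding_vertex]), and adding it would raise the potential.  If most
    of N(U) were not separated, a typical vertex v of N(U) would have many
    neighbours in large classes but would meet each of these classes in few
    vertices, so that adding v would separate d/10 new vertices
    ([separating_vertex]).

    Both facts rest on one spectral estimate ([nbr_second_moment]):
      sum_v |N(v) :&: S|^2 <= d^2 |S|^2 / n + lambda^2 |S|.
    Summed over the classes of U it shows that neighbourhoods meet classes in
    few vertices; rewritten as a variance it gives [discrepancy]; and for
    S = {v} it gives d >= K^2, so that log (d/K) is at least half of log d. *)

Set Implicit Arguments.
Unset Strict Implicit.
Unset Printing Implicit Defensive.

Import Order.TTheory GRing.Theory Num.Theory.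
Local Open Scope ring_scope.

(** * A spectral gap bound for normal matrices *)

Section NormalMatrices.
Local Open Scope sesquilinear_scope.

Lemma char_poly_similar (F : fieldType) n (P A : 'M[F]_n) :
  P \in unitmx -> char_poly (invmx P *m A *m P) = char_poly A.
Proof.
move=> Pu; pose Q := map_mx polyC P; pose Q' := map_mx polyC (invmx P).
have QQ : Q' *m Q = 1%:M by rewrite -map_mxM mulVmx // map_mx1.
rewrite /char_poly.
have -> : char_poly_mx (invmx P *m A *m P) = Q' *m char_poly_mx A *m Q.
  rewrite /char_poly_mx !map_mxM mulmxBr mulmxBl; congr (_ - _).
  by rewrite mul_mx_scalar -scalemxAl QQ scalemx1.
rewrite !det_mulmx mulrC mulrA -det_mulmx.
by rewrite (mulmx1C QQ) det1 mul1r.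
Qed.

(** In an orthonormal basis of eigenvectors, e has a single nonzero coordinate,
    because a is a simple eigenvalue.  The first term on the right is the
    contribution of that coordinate to the norm of x A; every other coordinate
    is multiplied by at most lam.  The factor |e|^2 on both sides avoids
    normalising e. *)
Lemma normal_mx_gap (C : numClosedFieldType) n (A : 'M[C]_n) (a lam : C)
    (s : seq C) (e x : 'rV[C]_n) :
    A \is normalmx -> char_poly A = \prod_(y <- a :: s) ('X - y%:P) ->
    0 <= lam -> (forall y, y \in s -> `|y| <= lam) -> a \notin s ->
    e *m A = a *: e ->
  (\sum_i `|(x *m A) 0 i| ^+ 2) * (\sum_i `|e 0 i| ^+ 2) <=
    `|a| ^+ 2 * `|\sum_i x 0 i * (e 0 i)^*| ^+ 2 +
    lam ^+ 2 * (\sum_i `|x 0 i| ^+ 2) * (\sum_i `|e 0 i| ^+ 2).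
Proof.
move=> /orthomx_spectralP; set P := spectralmx A; set D := spectral_diag A.
move=> AE chA lam0 lamP a_s eA.
have PU : P \is unitarymx by exact: spectral_unitarymx.
have Pu : P \in unitmx by exact: unitarymx_unit.
pose h (u : 'rV[C]_n) := u *m P^t*.
have dotE (u v : 'rV[C]_n) :
    \sum_i u 0 i * (v 0 i)^* = \sum_i h u 0 i * (h v 0 i)^*.
  have dE (w z : 'rV[C]_n) : \sum_i w 0 i * (z 0 i)^* = (w *m z^t*) 0 0.
    by rewrite mxE; apply: eq_bigr => i _; rewrite !mxE.
  rewrite !dE /h trmx_mul map_mxM trmxCK mulmxA.
  by rewrite mulmxKtV.
have nrmE (u : 'rV[C]_n) : \sum_i `|u 0 i| ^+ 2 = \sum_i `|h u 0 i| ^+ 2.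
  have := dotE u u; under eq_bigr do rewrite -normCK.
  by move=> ->; apply: eq_bigr => i _; rewrite -normCK.
have hA (u : 'rV[C]_n) i : h (u *m A) 0 i = h u 0 i * D 0 i.
  rewrite /h AE invmx_unitary // !mulmxA mulmxtVK //.
  by rewrite mul_mx_diag mxE.
have permD : perm_eq [seq D 0 i | i : 'I_n] (a :: s).
  apply: prod_XsubC_eq; rewrite -chA AE char_poly_similar //.
  rewrite char_poly_trig ?diag_mx_is_trig // big_map -big_enum /=.
  by apply: eq_bigr => i _; rewrite mxE eqxx mulr1n.
have aD : a \in [seq D 0 i | i : 'I_n] by rewrite (perm_mem permD) mem_head.
have /mapP[i0 _ aE] := aD.
have Dneq i : i != i0 -> D 0 i \in s.
  move=> ii0; have : perm_eq [seq D 0 i | i <- rem i0 (enum 'I_n)] s.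
    have := perm_to_rem (mem_enum 'I_n i0) => /(perm_map (fun i => D 0 i)).
    rewrite perm_sym => /perm_trans /(_ permD) /=.
    by rewrite -aE perm_cons.
  move/perm_mem <-; apply: map_f.
  by rewrite (mem_rem_uniq _ (enum_uniq _)) inE ii0 mem_enum.
have he i : i != i0 -> h e 0 i = 0.
  move=> ii0; apply/eqP; have := hA e i; rewrite eA /h -scalemxAl mxE -/(h e).
  move/eqP; rewrite mulrC -subr_eq0 -mulrBr mulf_eq0 subr_eq0 => /orP[//|/eqP aD'].
  by move: a_s; rewrite aD' Dneq.
rewrite (nrmE (x *m A)) (nrmE x) (nrmE e) (dotE x e).
rewrite [\sum_i `|h e _ _| ^+ 2](bigD1 i0) //=
  [\sum_(i | i != i0) `|h e _ _| ^+ 2]big1 ?addr0; last first.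
  by move=> i /he ->; rewrite normr0 expr0n.
rewrite [\sum_i h x _ _ * _](bigD1 i0) //=
  [\sum_(i | i != i0) h x _ _ * _]big1 ?addr0; last first.
  by move=> i /he ->; rewrite conjC0 mulr0.
rewrite normrM norm_conjC exprMn [X in _ <= X + _]mulrA -mulrDl.
rewrite ler_wpM2r ?exprn_ge0 //.
rewrite (bigD1 i0) //= [\sum_i `|h x _ _| ^+ 2](bigD1 i0) //=.
rewrite hA -aE normrM exprMn mulrC lerD2l.
apply: (@le_trans _ _ (lam ^+ 2 * \sum_(i | i != i0) `|h x 0 i| ^+ 2)).
  rewrite mulr_sumr; apply: ler_sum => i ii0.
  rewrite hA normrM exprMn mulrC ler_wpM2r ?exprn_ge0 //.
  by rewrite lerXn2r ?nnegrE // lamP ?Dneq.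
by rewrite ler_wpM2l ?exprn_ge0 // lerDr exprn_ge0.
Qed.

End NormalMatrices.

(** * The second moment of neighbourhood sizes *)

Definition nbr (G : sgraph) (v : G) : {set G} := [set w | adj v w].

Lemma regular_sum_nbr (G : sgraph) d (S : {set G}) :
  regular G d -> (\sum_(v : G) #|nbr v :&: S| = d * #|S|)%N.
Proof.
move=> reg.
transitivity (\sum_(v : G) \sum_(w in S) (adj v w : nat))%N.
  apply: eq_bigr => v _; rewrite -sum1_card big_mkcond [RHS]big_mkcond /=.
  by apply: eq_bigr => w _; rewrite !inE; case: (adj v w); case: (w \in S).
rewrite exchange_big /= mulnC -sum_nat_const; apply: eq_bigr => w _.
rewrite -(reg w) -sum1_card [RHS]big_mkcond /=.
by apply: eq_bigr => v _; rewrite !inE adj_sym; case: ifP.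
Qed.

Lemma sum_vertex (V : nmodType) (G : sgraph) (F : G -> V) :
  \sum_(v : G) F v = \sum_(i < #|G|) F (enum_val i).
Proof. by rewrite -(big_enum_val (A := G)). Qed.

(** The constant vector is an eigenvector for d.  All the eigenvalues after the
    first lie between lambda_n and lambda_2, hence have absolute value at most
    lam < d; so d can only be the first one, and it is simple. *)
Lemma spectrum_head (R : realType) (G : sgraph) n d (lam : R) :
  (0 < n)%N -> ndl_graph n d lam G -> lam < d%:R ->
  exists2 s : seq R, char_poly (adjmx R G) = \prod_(y <- d%:R :: s) ('X - y%:P) &
    forall y, y \in s -> `|y| <= lam.
Proof.
move=> n0 [cG reg [s [srt chs] lamE]] lamd.
have szs : size s = n.
  have := size_char_poly (adjmx R G).
  by rewrite chs size_prod_XsubC cG => -[].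
have ds : d%:R \in s.
  rewrite -root_prod_XsubC -chs -eigenvalue_root_char.
  apply/eigenvalueP; exists (const_mx 1).
    apply/rowP => j; rewrite !mxE mulr1 -(reg (enum_val j)) -sum1_card natr_sum.
    rewrite [RHS]big_mkcond [RHS]sum_vertex; apply: eq_bigr => i _.
    by rewrite !mxE !inE adj_sym mul1r; case: adj.
  rewrite -cG in n0; apply/negP => /eqP/rowP/(_ (Ordinal n0)).
  by rewrite !mxE => /eqP; rewrite oner_eq0.
case: s => [|s0 s] in srt chs lamE szs ds *; first by rewrite -szs in n0.
have sP y : y \in s -> `|y| <= lam.
  move=> ys; have := ys; rewrite -index_mem => ilt.
  have nthE : nth 0 (s0 :: s) (index y s).+1 = y by rewrite /= nth_index.
  have srt_nth := sorted_leq_nth (fun y x z (h1 : y <= x) (h2 : z <= y) => le_trans h2 h1)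
    (fun x => lexx x) 0 srt.
  have y1 : y <= (s0 :: s)`_1.
    by rewrite -nthE; apply: srt_nth; rewrite ?inE //= ltnS; apply: leq_ltn_trans ilt.
  have yn : (s0 :: s)`_n.-1 <= y.
    rewrite -[X in _ <= X]nthE; apply: srt_nth; rewrite ?inE //=.
    - by rewrite -szs.
    - by rewrite -szs.
  rewrite lamE le_max.
  have [yge0|/ltW ylt0] := lerP 0 y.
    by rewrite (le_trans _ (ler_norm _)) // ger0_norm.
  by rewrite orbC -[`|_`_n.-1|]normrN (le_trans _ (ler_norm _)) // ler0_norm // lerN2.
exists s => //; move: ds; rewrite chs in_cons => /orP[/eqP -> //|/sP].
by rewrite ger0_norm ?ler0n // leNgt lamd.
Qed.

(** This is [normal_mx_gap] for the indicator vector of S and the all-ones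
    eigenvector e; the spectral theorem is applied over the complex numbers
    R[i]. *)
Lemma nbr_second_moment (R : realType) (G : sgraph) n d (lam : R) (S : {set G}) :
  (0 < n)%N -> ndl_graph n d lam G -> lam < d%:R ->
  (\sum_(v : G) #|nbr v :&: S|%:R ^+ 2) * n%:R <=
     d%:R ^+ 2 * #|S|%:R ^+ 2 + lam ^+ 2 * #|S|%:R * n%:R.
Proof.
move=> n0 ndl lamd; have [s chs sP] := spectrum_head n0 ndl lamd.
have [cG reg [t _ lamE]] := ndl.
pose C := R[i]; pose f : {rmorphism R -> C} := real_complex R.
pose e : 'rV[C]_#|G| := const_mx 1.
pose x : 'rV[C]_#|G| := \row_i (enum_val i \in S)%:R.
pose A : 'M[C]_#|G| := map_mx f (adjmx R G).
have symA : A \is symmetricmx.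
  by apply/is_hermitianmxP; rewrite expr0 scale1r map_mx_id //;
    apply/matrixP => i j; rewrite !mxE adj_sym.
have realA : A \is a mxOver Num.real.
  by apply/mxOverP => i j; rewrite !mxE rmorph_nat realn.
have normA : A \is normalmx by exact: symmetric_normalmx.
have degE (v : G) : \sum_(w : G) (adj v w)%:R = d%:R :> C.
  rewrite -(reg v) -sum1_card natr_sum [RHS]big_mkcond; apply: eq_bigr => i _.
  by rewrite !inE; case: adj.
have xA i : (x *m A) 0 i = #|nbr (enum_val i) :&: S|%:R.
  rewrite mxE -sum1_card natr_sum [RHS]big_mkcond [RHS]sum_vertex; apply: eq_bigr => j _.
  by rewrite !mxE rmorph_nat -natrM mulnb !inE adj_sym andbC; case: ifP.
have lam0 : 0 <= lam by rewrite lamE le_max normr_ge0.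
have chA : char_poly A = \prod_(y <- f d%:R :: map f s) ('X - y%:P).
  rewrite -map_char_poly chs map_prod_XsubC -[_ :: map _ _]/(map f (d%:R :: s)).
  by rewrite big_map.
have fsP y : y \in map f s -> `|y| <= f lam.
  move=> /mapP[z zs ->]; rewrite /f /= normc_def /= expr0n addr0 sqrtr_sqr.
  by rewrite lecR sP.
have ds : f d%:R \notin map f s.
  apply/negP => /mapP[y ys /complexI dy]; have := sP y ys.
  by rewrite -dy ger0_norm ?ler0n // leNgt lamd.
have eA : e *m A = f d%:R *: e.
  apply/rowP => j; rewrite !mxE mulr1 rmorph_nat -(degE (enum_val j)) sum_vertex.
  by apply: eq_bigr => i _; rewrite !mxE mul1r rmorph_nat adj_sym.
have flam0 : 0 <= f lam by rewrite -(rmorph0 f) lecR.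
have := normal_mx_gap x normA chA flam0 fsP ds eA.
have -> : \sum_i `|e 0 i| ^+ 2 = n%:R.
  under eq_bigr do rewrite mxE normr1 expr1n.
  by rewrite sumr_const card_ord cG.
have -> : \sum_i `|x 0 i| ^+ 2 = #|S|%:R.
  rewrite -sum1_card natr_sum [RHS]big_mkcond [RHS]sum_vertex.
  by apply: eq_bigr => i _; rewrite mxE; case: (_ \in S);
    rewrite ?normr1 ?normr0 ?expr1n ?expr0n.
have -> : \sum_i x 0 i * (e 0 i)^* = #|S|%:R.
  rewrite -sum1_card natr_sum [RHS]big_mkcond [RHS]sum_vertex.
  by apply: eq_bigr => i _; rewrite !mxE conjC1 mulr1; case: (_ \in S).
have -> : \sum_i `|(x *m A) 0 i| ^+ 2 = \sum_(v : G) #|nbr v :&: S|%:R ^+ 2.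
  by rewrite sum_vertex; apply: eq_bigr => i _; rewrite xA normr_nat.
rewrite rmorph_nat !normr_nat -(rmorph_nat f n) -(rmorph_nat f #|S|) -(rmorph_nat f d).
have -> : \sum_(v : G) #|nbr v :&: S|%:R ^+ 2 = f (\sum_(v : G) #|nbr v :&: S|%:R ^+ 2).
  by rewrite rmorph_sum; apply: eq_bigr => v _; rewrite rmorphXn rmorph_nat.
by rewrite -!rmorphXn -!rmorphM -rmorphD lecR.
Qed.

(** * Recovering neighbourhood counts from isomorphism classes *)

Lemma graph_iso_refl G : graph_iso G G.
Proof. by exists id => //; exists id. Qed.

Lemma graph_iso_sym G H : graph_iso G H -> graph_iso H G.
Proof.
move=> [f [g fK gK] fadj]; exists g; first by exists f.
by move=> x y; rewrite -fadj !gK.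
Qed.

Lemma graph_iso_trans G H K : graph_iso G H -> graph_iso H K -> graph_iso G K.
Proof.
move=> [f fb fadj] [g gb gadj]; exists (g \o f); first exact: bij_comp.
by move=> x y; rewrite /= gadj fadj.
Qed.

Lemma card_ord_le m n : (m <= n)%N -> #|[pred i : 'I_n.+1 | (i <= m)%N]| = m.+1.
Proof. by move=> mn; rewrite -sum1_card (big_ord_narrow_leq mn) sum1_card card_ord. Qed.

Section Profiles.
Variable G : sgraph.
Implicit Types U S T W p : {set G}.

Definition nbr_in U (w : G) : {set G} := nbr w :&: U.

(** The homomorphisms from U to G.  They are encoded as finite functions on G
    that are the identity outside U, so that each of them is counted once. *)
Definition homs U : {set {ffun G -> G}} :=
  [set f : {ffun G -> G} |
    [forall x in U, forall y in U, adj x y ==> adj (f x) (f y)] &&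
    [forall x in ~: U, f x == x]].

Lemma homsP U (f : {ffun G -> G}) :
  reflect ({in U &, forall x y, adj x y -> adj (f x) (f y)} /\
           (forall x, x \notin U -> f x = x)) (f \in homs U).
Proof.
rewrite inE; apply: (iffP andP) => -[].
  move=> /forall_inP adjf /forall_inP idf; split=> [x y xU yU|x xU].
    by move/forall_inP: (adjf _ xU) => /(_ _ yU) /implyP.
  by apply/eqP/idf; rewrite inE.
move=> adjf idf; split; apply/forall_inP => x.
  by move=> xU; apply/forall_inP => y yU; apply/implyP/adjf.
by rewrite inE => /idf ->.
Qed.

Lemma card_homs1 (v : G) : (#|homs [set v]| <= #|G|)%N.
Proof.
pose ev (f : {ffun G -> G}) := f v.
rewrite -(card_in_imset (f := ev)) ?max_card //.
move=> f g /homsP[_ fid] /homsP[_ gid] fg; apply/ffunP => x.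
by have [->//|xv] := eqVneq x v; rewrite fid ?gid // inE.
Qed.

(** A homomorphism of v |: U is determined by its restriction to U and by the
    image of v, which is one of the d neighbours of the image of x. *)
Lemma card_homs_add d U v x : regular G d -> x \in U -> v \notin U -> adj x v ->
  (#|homs (v |: U)| <= #|homs U| * d)%N.
Proof.
move=> reg xU vU xv.
pose restr (f : {ffun G -> G}) := [ffun y => if y == v then v else f y].
rewrite -sum1_card (partition_big restr (mem (homs U))) /=; last first.
  move=> f /homsP[adjf idf]; apply/homsP; split=> [y z yU zU yz|y yU].
    have neq t : t \in U -> (t == v) = false.
      by move=> tU; apply: contraNF vU => /eqP <-.
    by rewrite !ffunE !neq //; apply: adjf => //; rewrite !inE ?yU ?zU orbT.
  by rewrite ffunE; case: eqP => // /eqP yv; apply: idf; rewrite !inE negb_or yv.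
rewrite -sum_nat_const; apply: leq_sum => h _; rewrite sum1_card.
pose ev (f : {ffun G -> G}) := f v.
rewrite -(reg (h x)) -(card_in_imset (f := ev)).
  apply/subset_leq_card/subsetP => _ /imsetP[f /andP[/homsP[adjf _] /eqP <-] ->].
  rewrite inE ffunE ifN; last by apply: contraNneq vU => <-.
  by apply: adjf; rewrite ?inE ?xU ?eqxx ?orbT.
move=> f g /andP[_ /eqP fh] /andP[_ /eqP gh] fg; apply/ffunP => y.
have [->//|yv] := eqVneq y v.
have := congr1 (fun k : {ffun G -> G} => k y) (etrans fh (esym gh)).
by rewrite !ffunE (negbTE yv).
Qed.

(** The image under phi of the trace of w on U is the trace of the image of w
    on phi @: U, so the number of vertices of trace p can be read off in T from
    phi alone. *)
Lemma iso_profile U S T : U \subset S -> graph_iso (induced S) (induced T) ->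
  exists2 phi, phi \in homs U & forall p, p \subset U ->
    #|[set w in S :\: U | nbr_in U w == p]| =
    #|[set y in T :\: phi @: U | nbr_in (phi @: U) y == phi @: p]|.
Proof.
move=> US [f [g fK gK] fadj].
pose psi x := if insub x is Some u then val (f u) else x.
have psiE x (xS : x \in S) : psi x = val (f (Sub x xS)).
  by rewrite /psi insubT.
have psiT x : x \in S -> psi x \in T by move=> xS; rewrite psiE; exact: valP.
have psi_adj x y : x \in S -> y \in S -> adj (psi x) (psi y) = adj x y.
  by move=> xS yS; rewrite !psiE; have := fadj (Sub x xS) (Sub y yS).
have psi_inj : {in S &, injective psi}.
  move=> x y xS yS; rewrite !psiE => /val_inj /(can_inj fK) /(congr1 val).
  by [].
have psi_surj y : y \in T -> exists2 x, x \in S & y = psi x.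
  move=> yT; exists (val (g (Sub y yT))); first exact: valP.
  have gS := valP (g (Sub y yT)).
  rewrite psiE [Sub _ _](_ : _ = g (Sub y yT)) ?gK //.
  exact: val_inj.
pose phi := [ffun x => if x \in U then psi x else x].
have phiE p : p \subset U -> phi @: p = psi @: p.
  by move=> /subsetP pU; apply: eq_in_imset => x /pU xU; rewrite ffunE xU.
exists phi.
  apply/homsP; split=> [x y xU yU|x /negbTE xU]; rewrite !ffunE ?xU ?yU //.
  by rewrite psi_adj ?(subsetP US).
move=> p pU; rewrite (phiE p) // (phiE U) //.
have nbr_inE w : w \in S -> nbr_in (psi @: U) (psi w) = psi @: nbr_in U w.
  move=> wS; apply/setP => z; rewrite !inE; apply/andP/imsetP.
    move=> [wz /imsetP[u uU zu]]; exists u => //; rewrite !inE uU andbT.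
    by move: wz; rewrite zu psi_adj // (subsetP US).
  move=> [u]; rewrite !inE => /andP[wu uU] ->.
  by split; [rewrite psi_adj // (subsetP US) | exact: imset_f].
rewrite -(card_in_imset (f := psi) (D := [set w in S :\: U | nbr_in U w == p])); last first.
  by move=> x y; rewrite !inE => /andP[/andP[_ xS] _] /andP[/andP[_ yS] _]; apply: psi_inj.
congr #|pred_of_set _|; apply/setP => y; apply/imsetP/idP.
  move=> [w]; rewrite !inE => /andP[/andP[wU wS] /eqP wp] ->.
  rewrite psiT // nbr_inE // wp eqxx !andbT.
  apply/imsetP => -[u uU] /psi_inj wu; move: wU; rewrite wu ?uU //.
  exact: (subsetP US).
rewrite !inE => /andP[/andP[yU yT]]; have [w wS yw] := psi_surj _ yT.
rewrite yw nbr_inE // => /eqP nbr_w; exists w => //; rewrite !inE wS andbT.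
apply/andP; split; first by apply: contra yU => wU; rewrite yw imset_f.
have inj_sub (A B : {set G}) :
    A \subset U -> psi @: A = psi @: B -> B \subset U -> A \subset B.
  move=> /subsetP AU AB /subsetP BU; apply/subsetP => z zA.
  have /imsetP[b bB zb] : psi z \in psi @: B by rewrite -AB imset_f.
  suff -> : z = b by [].
  by apply: psi_inj zb; apply: (subsetP US); [exact: AU | exact: BU].
have nbr_inU : nbr_in U w \subset U by exact: subsetIr.
rewrite eqEsubset; apply/andP.
by split; [exact: inj_sub nbr_w pU | exact: inj_sub (esym nbr_w) nbr_inU].
Qed.

Let isoR : rel {set G} := fun S T => `[< graph_iso (induced S) (induced T) >].

Lemma isoR_equiv : {in [set: {set G}] & &, equivalence_rel isoR}.
Proof.
move=> S T K _ _ _; split; first by apply/asboolP/graph_iso_refl.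
move=> /asboolP ST; apply/asboolP/asboolP; last exact: graph_iso_trans.
by apply: graph_iso_trans; apply: graph_iso_sym.
Qed.

(** Each factor on the left counts the possible numbers of chosen vertices of
    trace p.  Every choice k of these numbers is realised by some U :|: W', and
    is recovered from the isomorphism class of the graph induced on it and a
    homomorphism of U, as in [iso_profile]. *)
Lemma prod_profiles_le U W : [disjoint U & W] ->
  (\prod_(p : {set G}) #|[set w in W | nbr_in U w == p]|.+1 <= num_induced G * #|homs U|)%N.
Proof.
move=> UW; pose C p := [set w in W | nbr_in U w == p].
pose F p : pred 'I_#|G|.+1 := fun i => (i <= #|C p|)%N.
have -> : (\prod_(p : {set G}) #|C p|.+1 =
    #|(family F : pred {ffun {set G} -> 'I_#|G|.+1})|)%N.
  rewrite card_family foldrE big_map big_enum /=; apply: eq_bigr => p _.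
  by rewrite card_ord_le // max_card.
pose P := equivalence_partition isoR [set: {set G}].
pose rep (B : {set {set G}}) := odflt set0 [pick T in B].
pose prof (c : {set {set G}} * {ffun G -> G}) p :=
  #|[set y in rep c.1 :\: c.2 @: U | nbr_in (c.2 @: U) y == c.2 @: p]|.
(* Only traces p inside U occur, but k is indexed by all subsets of G; outside
   U the count is 0. *)
pose recover c := [ffun p : {set G} =>
  inord (if p \subset U then prof c p else 0) : 'I_#|G|.+1].
have -> : num_induced G = #|P| by [].
rewrite -cardsX.
suff sub : family F \subset recover @: setX P (homs U).
  by apply: leq_trans (subset_leq_card sub) _; exact: leq_imset_card.
apply/subsetP => k /familyP kF.
pose S := U :|: [set w in W | w \in take (k (nbr_in U w)) (enum (C (nbr_in U w)))].
have partP : partition P [set: {set G}] := equivalence_partitionP isoR_equiv.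
have US : U \subset S by exact: subsetUl.
have iso : graph_iso (induced S) (induced (rep (pblock P S))).
  rewrite /rep; case: pickP => [T | /(_ S)] /=; last first.
    by rewrite mem_pblock (cover_partition partP) inE.
  by rewrite pblock_equivalence_partition ?inE //; [move/asboolP | exact: isoR_equiv].
have [phi phi_hom phiE] := iso_profile US iso.
apply/imsetP; exists (pblock P S, phi).
  by rewrite inE /= phi_hom pblock_mem // (cover_partition partP) inE.
apply/ffunP => p; rewrite ffunE; apply/val_inj.
have C0 : ~~ (p \subset U) -> #|C p| = 0%N.
  move=> pU; apply/eqP; rewrite cards_eq0; apply/set0Pn => -[w].
  by rewrite inE => /andP[_ /eqP pw]; move: pU; rewrite -pw subsetIr.
have kp : (k p <= #|C p|)%N := kF p.
case: ifP => [pU|/negbT/C0 Cp]; last first.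
  by rewrite /= inordK //; apply/eqP; rewrite -leqn0 -Cp.
rewrite /prof /= -phiE // inordK ?ltnS ?max_card //.
rewrite (_ : [set w in _ | _] = [set w in take (k p) (enum (C p))]).
  rewrite cardsE (card_uniqP _) ?size_take_min ?take_uniq ?enum_uniq //.
  by rewrite -cardE; apply/esym/minn_idPl.
apply/setP => w; rewrite !inE; apply/andP/idP.
  by move=> [/andP[/negbTE-> /=]] /andP[_] + /eqP pw; rewrite pw.
move=> wt; have := mem_take wt; rewrite mem_enum inE => /andP[wW /eqP pw].
rewrite pw eqxx wW wt orbT andbT; split=> //.
by apply: contraTN wW => wU; rewrite (disjointFr UW).
Qed.
End Profiles.

(** * A small set that separates many vertices *)

Section Expansion.
Variable G : sgraph.
Implicit Types (U S T W X B p : {set G}) (v w : G).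

Definition twins U w : {set G} := [set w' | nbr_in U w' == nbr_in U w].
Definition nbhd U : {set G} := [set w | nbr_in U w != set0].
Definition separated M U : {set G} := [set w in nbhd U | (#|twins U w| <= M)%N].
(** The neighbours w of v that adding v to U is certain to separate: the
    step leaves the class of w inside N(v) :&: twins U w. *)
Definition newly_separated M U v : {set G} :=
  [set w in nbr v :&: (nbhd U :\: separated M U) | (#|nbr v :&: twins U w| <= M)%N].

Lemma nbr_in_sub U S w : U \subset S -> nbr_in S w :&: U = nbr_in U w.
Proof. by move=> /setIidPr US; rewrite /nbr_in -setIA US. Qed.

Lemma nbr_in_eq_sub U S w w' :
  U \subset S -> nbr_in S w = nbr_in S w' -> nbr_in U w = nbr_in U w'.
Proof. by move=> US e; rewrite -!(nbr_in_sub _ US) e. Qed.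

Lemma nbhd_mono U S : U \subset S -> nbhd U \subset nbhd S.
Proof.
move=> US; apply/subsetP => w; rewrite !inE; apply: contraNneq => e.
by rewrite -(nbr_in_sub w US) e set0I.
Qed.

Lemma nbr_sub_nbhd U v : nbr v \subset nbhd (v |: U).
Proof.
apply/subsetP => w; rewrite !inE => vw; apply/set0Pn; exists v.
by rewrite !inE eqxx andbT adj_sym.
Qed.

Lemma separated_mono M U S : U \subset S -> separated M U \subset separated M S.
Proof.
move=> US; apply/subsetP => w; rewrite inE => /andP[wU wM].
rewrite inE (subsetP (nbhd_mono US)) //=; apply: leq_trans wM.
by apply/subset_leq_card/subsetP => z; rewrite !inE => /eqP/(nbr_in_eq_sub US)->.
Qed.

Lemma newly_separated_sub M U v : newly_separated M U v \subset separated M (v |: U).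
Proof.
apply/subsetP => w; rewrite inE => /andP[]; rewrite inE => /andP[wv _] wM.
rewrite inE (subsetP (nbr_sub_nbhd U v)) //=; apply: leq_trans wM.
apply/subset_leq_card/subsetP => z; rewrite inE => /eqP zw.
rewrite !inE (nbr_in_eq_sub (subsetUr [set v] U) zw) eqxx andbT.
have : v \in nbr_in (v |: U) w by rewrite !inE eqxx andbT adj_sym; move: wv; rewrite inE.
by rewrite -zw !inE eqxx andbT adj_sym.
Qed.

Lemma card_separated_add M U v :
  (#|separated M U| + #|newly_separated M U v| <= #|separated M (v |: U)|)%N.
Proof.
rewrite -cardsUI [separated M U :&: _](_ : _ = set0) ?cards0 ?addn0.
  by apply: subset_leq_card; rewrite subUset newly_separated_sub separated_mono // subsetUr.
by apply/setP => w; rewrite !inE; case: (nbr_in U w != set0);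
  case: (#|twins U w| <= M)%N; rewrite //= ?andbF.
Qed.

Lemma card_nbhd_add U v : (#|nbhd U| + #|nbr v :\: nbhd U| <= #|nbhd (v |: U)|)%N.
Proof.
rewrite -cardsUI [nbhd U :&: _](_ : _ = set0) ?cards0 ?addn0.
  apply: subset_leq_card; rewrite subUset nbhd_mono ?subsetUr //=.
  exact: subset_trans (subsetDl _ _) (nbr_sub_nbhd U v).
by apply/setP => w; rewrite inE [w \in _ :\: _]inE [RHS]inE; case: (w \in nbhd U).
Qed.

(** A neighbour of v that adding v need not separate has more than M
    neighbours of v in its class, so each class C contributes at most
    |N(v) :&: C|^2 to the count weighted by M + 1. *)
Lemma card_unseparated_le M U v B : B = nbhd U :\: separated M U ->
  (M.+1 * #|(nbr v :&: B) :\: newly_separated M U v| <=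
   \sum_(p : {set G}) #|nbr v :&: [set w in B | nbr_in U w == p]| ^ 2)%N.
Proof.
move=> BE; have twinsB w : w \in B -> twins U w = [set w' in B | nbr_in U w' == nbr_in U w].
  move=> wB; apply/setP => z; rewrite [RHS]inE [LHS]inE; case: eqP => [zw|];
    rewrite ?andbF ?andbT //.
  have czw : twins U z = twins U w by apply/setP => t; rewrite !inE zw.
  by move: wB; rewrite BE !inE czw zw => ->.
rewrite mulnC -sum_nat_const.
apply: (@leq_trans (\sum_(w in nbr v :&: B) #|nbr v :&: twins U w|)).
  rewrite [X in (_ <= X)%N](big_setID (newly_separated M U v)) /=.
  apply: leq_trans (leq_addl _ _).
  apply: leq_sum => w; rewrite inE => /andP[wl wB].
  by move: wl; rewrite inE -BE wB /= -ltnNge.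
rewrite (partition_big (nbr_in U) predT) //=; apply: leq_sum => p _.
rewrite -mulnn -sum_nat_const leq_eqVlt; apply/orP; left; apply/eqP.
apply: eq_big => [w|w /andP[wB /eqP wp]].
  by rewrite in_setI [RHS]in_setI [X in _ = _ && X]inE andbA.
by rewrite twinsB ?wp //; move: wB; rewrite inE => /andP[].
Qed.

Section Mixing.
Variables (R : realType) (d : nat) (L : R).
Hypotheses (reg : regular G d) (L0 : 0 < L) (n0 : (0 < #|G|)%N).
Let n : R := #|G|%:R.
(* L is a positive upper bound for lambda. *)
Hypothesis mix : forall S, (\sum_(v : G) #|nbr v :&: S|%:R ^+ 2) * n <=
     d%:R ^+ 2 * #|S|%:R ^+ 2 + L ^+ 2 * #|S|%:R * n.

Let n_gt0 : 0 < n. Proof. by rewrite ltr0n. Qed.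

(** By regularity, m = d |S| / n is the mean of |N(v) :&: S| over the vertices
    v; the bound is the second moment inequality after expanding the square. *)
Lemma variance S :
  \sum_(v : G) (#|nbr v :&: S|%:R - d%:R * #|S|%:R / n) ^+ 2 <= L ^+ 2 * #|S|%:R.
Proof.
rewrite -(ler_pM2r n_gt0).
set m := d%:R * #|S|%:R / n.
have -> : \sum_v (#|nbr v :&: S|%:R - m) ^+ 2 =
    \sum_v #|nbr v :&: S|%:R ^+ 2 - m ^+ 2 * n.
  transitivity (\sum_v (#|nbr v :&: S|%:R ^+ 2 - (2 * m * #|nbr v :&: S|%:R - m ^+ 2))).
    by apply: eq_bigr => v _; ring.
  rewrite sumrB; congr (_ - _); rewrite sumrB -mulr_sumr -natr_sum (regular_sum_nbr _ reg).
  rewrite sumr_const -[m ^+ 2 *+ _]mulr_natr natrM -/n.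
  have -> : d%:R * #|S|%:R = m * n by rewrite /m divfK // gt_eqF.
  ring.
rewrite mulrBl lerBlDl; apply: le_trans (mix S) _; rewrite lerD2r.
have -> : m ^+ 2 * n * n = (m * n) ^+ 2 by ring.
by rewrite /m divfK ?gt_eqF // exprMn.
Qed.

(** The expander mixing inequality in the case |S| <= |X|, where its error term
    L sqrt (|X| |S|) is at most L |X|. *)
Lemma discrepancy X S : (#|S| <= #|X|)%N ->
  `|\sum_(v in X) #|nbr v :&: S|%:R - #|X|%:R * (d%:R * #|S|%:R / n)| <= L * #|X|%:R.
Proof.
move=> SX; set m := d%:R * _ / n.
have -> : \sum_(v in X) #|nbr v :&: S|%:R - #|X|%:R * m =
    \sum_(v in X) (#|nbr v :&: S|%:R - m).
  by rewrite sumrB sumr_const mulr_natl.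
apply: le_trans (ler_norm_sum _ _ _) _.
(* |t| <= t^2 / (2L) + L / 2, so the variance bound controls the first moment. *)
apply: (@le_trans _ _ (\sum_(v in X) ((#|nbr v :&: S|%:R - m) ^+ 2 / (2 * L) + L / 2))).
  apply: ler_sum => v _; set t := _ - m.
  rewrite -[t ^+ 2]real_normK ?num_real // -subr_ge0.
  have -> : `|t| ^+ 2 / (2 * L) + L / 2 - `|t| = (`|t| - L) ^+ 2 / (2 * L).
    by field; rewrite gt_eqF.
  by rewrite divr_ge0 ?sqr_ge0 // mulr_ge0 // ltW.
rewrite big_split /= sumr_const -mulr_suml -mulr_natr.
have : \sum_(v in X) (#|nbr v :&: S|%:R - m) ^+ 2 <= L ^+ 2 * #|X|%:R.
  apply: le_trans (_ : _ <= L ^+ 2 * #|S|%:R) _; last by rewrite ler_wpM2l ?sqr_ge0 // ler_nat.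
  apply: le_trans (variance S); rewrite -/m [leRHS](bigID (mem X)) /= lerDl.
  by apply: sumr_ge0 => v _; exact: sqr_ge0.
set s := \sum_(v in X) _ => sle.
have : s / (2 * L) <= L ^+ 2 * #|X|%:R / (2 * L).
  by rewrite ler_wpM2r // invr_ge0 mulr_ge0 // ltW.
have -> : L ^+ 2 * #|X|%:R / (2 * L) = L * #|X|%:R / 2 by field; rewrite gt_eqF.
lra.
Qed.

(** On average a vertex of X = N(U) has at most d |X| / n + L <= 7 d / 10
    neighbours in X, hence some vertex of X has a quarter of its neighbours
    outside X. *)
Lemma expanding_vertex U : nbhd U != set0 -> #|nbhd U|%:R <= n / 2 -> L <= d%:R / 5 ->
  exists2 v, v \in nbhd U & d%:R / 4 <= #|nbr v :\: nbhd U|%:R :> R.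
Proof.
set X := nbhd U => X0 Xn Ld; apply/exists_inP; apply: contraT.
rewrite negb_exists_in => /forall_inP far.
have X_gt0 : 0 < #|X|%:R :> R by rewrite ltr0n card_gt0.
have := @discrepancy X X (leqnn _); rewrite ler_norml => /andP[_].
set s := \sum_(v in X) _ => sle.
have : 3 / 4 * d%:R * #|X|%:R <= s.
  have -> : 3 / 4 * d%:R * #|X|%:R = \sum_(v in X) (3 / 4 * d%:R) :> R.
    by rewrite sumr_const mulr_natr.
  apply: ler_sum => v vX.
  have := far v vX; rewrite -ltNge => vlt.
  have : #|nbr v :&: X|%:R + #|nbr v :\: X|%:R = d%:R :> R.
    by rewrite -natrD cardsID reg.
  lra.
set y := d%:R * #|X|%:R / n in sle *.
have yle : y <= d%:R / 2.
  have := ler_wpM2l (ler0n R d) Xn; rewrite /y ler_pdivrMr //; lra.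
have : 0 < #|X|%:R * (3 / 4 * d%:R - y - L) by rewrite mulr_gt0 //; move: L0 Ld yle; lra.
lra.
Qed.

(** Let B be the set of the unseparated vertices of N(U), at least n/4 in
    number.  On average a vertex of N(U) has at least d/4 - L neighbours in B.
    By [card_unseparated_le] and the second moment bound applied to each class,
    those not certain to be separated number at most d/20 on average, since
    every class has at most d elements. *)
Lemma separating_vertex (K : R) M U : 0 < K -> n <= 2 * #|nbhd U|%:R ->
  2 * #|separated M U|%:R <= #|nbhd U|%:R :> R -> L <= d%:R / 20 ->
  40 * K * d%:R <= n -> 40 * K * L ^+ 2 <= d%:R ^+ 2 -> d%:R <= K * M.+1%:R ->
  exists2 v, v \in nbhd U & d%:R / 10 <= #|newly_separated M U v|%:R :> R.
Proof.
set X := nbhd U => K0 nX gX Ld dn LK dM.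
apply/exists_inP; apply: contraT.
rewrite negb_exists_in => /forall_inP few.
pose B := X :\: separated M U.
have separatedX : separated M U \subset X by apply/subsetP => w; rewrite inE => /andP[].
have BX : B \subset X by exact: subsetDl.
have cB : #|B|%:R = #|X|%:R - #|separated M U|%:R :> R.
  by rewrite cardsD (setIidPr separatedX) natrB // subset_leq_card.
have X_gt0 : 0 < #|X|%:R :> R by have := n_gt0; lra.
have := discrepancy (subset_leq_card BX); rewrite ler_norml => /andP[+ _].
set s := \sum_(v in X) _; set y := d%:R * #|B|%:R / n => sge.
have yge : d%:R / 4 <= y.
  have Bn : n / 4 <= #|B|%:R by lra.
  have := ler_wpM2l (ler0n R d) Bn; rewrite /y ler_pdivlMr //; lra.
pose heavy v : R := #|(nbr v :&: B) :\: newly_separated M U v|%:R.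
have sle : s <= d%:R / 10 * #|X|%:R + \sum_(v in X) heavy v.
  have -> : d%:R / 10 * #|X|%:R = \sum_(v in X) (d%:R / 10) :> R.
    by rewrite sumr_const mulr_natr.
  rewrite -big_split; apply: ler_sum => v vX /=.
  have := few v vX; rewrite -ltNge.
  have : #|nbr v :&: B|%:R = #|newly_separated M U v|%:R + heavy v.
    rewrite -natrD -(cardsID (newly_separated M U v)) (setIidPr _) //.
    by apply/subsetP => w; rewrite inE => /andP[].
  lra.
pose C p := [set w in B | nbr_in U w == p].
(* A class with nonempty trace lies in the neighbourhood of any x in the trace. *)
have cardC p : #|C p|%:R <= d%:R :> R.
  rewrite ler_nat; have [->|/set0Pn[w]] := eqVneq (C p) set0; first by rewrite cards0.
  rewrite !inE => /andP[/andP[_ /set0Pn[x]]] + /eqP wp.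
  rewrite wp => xp; rewrite -(reg x); apply/subset_leq_card/subsetP => z.
  by rewrite !inE => /andP[_ /eqP zp]; move: xp; rewrite -zp !inE adj_sym => /andP[].
have sumC : \sum_(p : {set G}) #|C p|%:R = #|B|%:R :> R.
  rewrite -natr_sum; congr _%:R; rewrite -sum1_card (partition_big (nbr_in U) predT) //=.
  by apply: eq_bigr => p _; rewrite -sum1_card; apply: eq_bigl => w; rewrite inE.
have heavy_le : M.+1%:R * \sum_(v in X) heavy v <= (d%:R ^+ 3 / n + L ^+ 2) * #|X|%:R.
  apply: (@le_trans _ _ (\sum_(v : G) \sum_(p : {set G}) #|nbr v :&: C p|%:R ^+ 2)).
    rewrite mulr_sumr [leRHS](bigID (mem X)) /= ler_wpDr //.
      by apply: sumr_ge0 => v _; apply: sumr_ge0 => p _; exact: sqr_ge0.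
    apply: ler_sum => v _; rewrite -natrM; have := card_unseparated_le v (erefl B).
    by rewrite -(ler_nat R) natr_sum; under eq_bigr do rewrite natrX.
  rewrite exchange_big /=.
  apply: (@le_trans _ _ (\sum_(p : {set G}) (d%:R ^+ 3 / n + L ^+ 2) * #|C p|%:R)).
    apply: ler_sum => p _; rewrite -(ler_pM2r n_gt0); apply: le_trans (mix _) _.
    have -> : (d%:R ^+ 3 / n + L ^+ 2) * #|C p|%:R * n =
       d%:R ^+ 2 * (d%:R * #|C p|%:R) + L ^+ 2 * #|C p|%:R * n.
      by field; rewrite gt_eqF.
    by rewrite lerD2r ler_wpM2l ?sqr_ge0 // expr2 ler_wpM2r ?ler0n.
  rewrite -mulr_sumr sumC ler_wpM2l ?ler_nat ?subset_leq_card //.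
  by rewrite addr_ge0 ?sqr_ge0 // divr_ge0 ?exprn_ge0 ?ler0n.
set h := \sum_(v in X) heavy v in sle heavy_le.
have d_gt0 : 0 < d%:R :> R by move: L0; lra.
have dh : d%:R * h <= d%:R * (d%:R / 20 * #|X|%:R).
  have h0 : 0 <= h by apply: sumr_ge0 => v _; exact: ler0n.
  have dnle : K * (d%:R ^+ 3 / n) <= d%:R ^+ 2 / 40.
    by rewrite mulrA ler_pdivrMr //; have := ler_wpM2l (sqr_ge0 (d%:R : R)) dn; lra.
  have := ler_wpM2r h0 dM; have := ler_wpM2l (ltW K0) heavy_le.
  have : K * (d%:R ^+ 3 / n + L ^+ 2) * #|X|%:R <= d%:R ^+ 2 / 20 * #|X|%:R.
    by rewrite ler_wpM2r ?ler0n // mulrDr; lra.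
  lra.
move: dh; rewrite ler_pM2l // => hX.
have : 0 < #|X|%:R * (y - d%:R / 20 - d%:R / 10 - d%:R / 20)
  by rewrite mulr_gt0 //; move: d_gt0 yge; lra.
have : #|X|%:R * L <= #|X|%:R * (d%:R / 20) by rewrite ler_wpM2l // ler0n.
lra.
Qed.

(** U is chosen to maximise F among the nonempty sets with few homomorphisms;
    this family is stable under the addition of a vertex of N(U).  Adding a
    vertex costs d, whereas the vertices of [expanding_vertex] and
    [separating_vertex] would bring at least 16 d / 10. *)
Lemma separating_set (K : R) M : 0 < K -> L <= d%:R / 20 ->
  40 * K * d%:R <= n -> 40 * K * L ^+ 2 <= d%:R ^+ 2 -> d%:R <= K * M.+1%:R ->
  exists U, [/\ (#|homs U| <= #|G| * d ^ #|U|)%N,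
    d%:R * #|U|%:R <= 32 * n + d%:R & n <= 4 * #|separated M U|%:R].
Proof.
move=> K0 Ld dn LK dM.
have d_gt0 : 0 < d%:R :> R by move: L0; lra.
pose P U := (U != set0) && (#|homs U| <= #|G| * d ^ #|U|)%N.
pose F U : R := 16 * (#|nbhd U|%:R + #|separated M U|%:R) - d%:R * #|U|%:R.
have /card_gt0P[v0 _] := n0.
have P0 : P [set v0].
  apply/andP; split; first by apply/set0Pn; exists v0; rewrite inE.
  by rewrite cards1 expn1 (leq_trans (card_homs1 v0)) // leq_pmulr // -(ltr_nat R).
case: (@arg_maxP _ _ _ [set v0] P F P0) => U /andP[/set0Pn[u uU] homU] maxU.
have gain v : v \in nbhd U -> 16 * (#|nbhd (v |: U)|%:R + #|separated M (v |: U)|%:R) <=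
    16 * (#|nbhd U|%:R + #|separated M U|%:R) + d%:R :> R.
  rewrite inE => /set0Pn[x]; rewrite !inE => /andP[vx xU].
  have cU : (#|v |: U| <= #|U|.+1)%N by rewrite cardsU1; case: (_ \notin _).
  have PvU : P (v |: U).
    apply/andP; split; first by apply/set0Pn; exists u; rewrite !inE uU orbT.
    have [vU|vU] := boolP (v \in U).
      by rewrite (setUidPr _) // sub1set.
    rewrite cardsU1 vU expnSr mulnA.
    have := card_homs_add reg xU vU; rewrite adj_sym => /(_ vx) /leq_trans; apply.
    by rewrite leq_mul2r homU orbT.
  have : F (v |: U) <= F U := maxU _ PvU; rewrite /F.
  have : d%:R * #|v |: U|%:R <= d%:R * (#|U|%:R + 1) :> R.
    by rewrite ler_pM2l // natr1 ler_nat.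
  lra.
have nbhdU0 : nbhd U != set0.
  have : (0 < #|nbr u|)%N by rewrite reg -(ltr_nat R).
  move=> /card_gt0P[w]; rewrite inE => uw; apply/set0Pn; exists w.
  by rewrite inE; apply/set0Pn; exists u; rewrite !inE uU adj_sym uw.
have nbhdU : n <= 2 * #|nbhd U|%:R.
  rewrite leNgt; apply/negP => small.
  have [||v vU far] := @expanding_vertex U nbhdU0; [by lra|by lra|].
  have := gain v vU.
  have := card_nbhd_add U v; rewrite -(ler_nat R) natrD.
  have := separated_mono M (subsetUr [set v] U); move/subset_leq_card; rewrite -(ler_nat R).
  lra.
have separatedU : #|nbhd U|%:R <= 2 * #|separated M U|%:R :> R.
  rewrite leNgt; apply/negP => small.
  have [v vU lv] := separating_vertex K0 nbhdU (ltW small) Ld dn LK dM.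
  have := gain v vU.
  have := card_separated_add M U v; rewrite -(ler_nat R) natrD.
  have := nbhd_mono (subsetUr [set v] U); move/subset_leq_card; rewrite -(ler_nat R).
  lra.
exists U; split=> //; last by lra.
have : F [set v0] <= F U := maxU _ P0; rewrite /F cards1.
have : #|nbhd U|%:R <= n by rewrite ler_nat max_card.
have : #|separated M U|%:R <= n by rewrite ler_nat max_card.
have : 0 <= #|nbhd [set v0]|%:R :> R by [].
have : 0 <= #|separated M [set v0]|%:R :> R by [].
lra.
Qed.

End Mixing.
End Expansion.

(** * Numerical estimates and conclusion *)

Lemma expn_succ_le j M : (j <= M.+1 -> M.+2 ^ j <= j.+1 * M.+1 ^ j)%N.
Proof.
elim: j => [//|j IH] jM; rewrite !expnS.
apply: (@leq_trans (M.+2 * (j.+1 * M.+1 ^ j))); first by rewrite leq_mul2l IH ?orbT // ltnW.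
rewrite !mulnA leq_mul2r; apply/orP; right; nia.
Qed.

(** This is the decrease of log (1 + x) / x, compared at m and M. *)
Lemma expn_swap m M : (m <= M -> M.+1 ^ m <= m.+1 ^ M)%N.
Proof.
move=> mM; elim: M mM => [|M IH]; first by rewrite leqn0 => /eqP ->.
rewrite leq_eqVlt => /orP[/eqP -> //|mM].
apply: leq_trans (expn_succ_le (ltnW mM)) _.
by rewrite expnS leq_mul2l IH ?orbT.
Qed.

Lemma exp_separated_le (G : sgraph) (U : {set G}) M :
  (M.+1 ^ #|separated M U :\: U| <= (num_induced G * #|homs U|) ^ M)%N.
Proof.
set W := separated M U :\: U.
have UW : [disjoint U & W].
  by rewrite -setI_eq0; apply/eqP/setP => w; rewrite !inE; case: (w \in U).
apply: (@leq_trans ((\prod_(p : {set G}) #|[set w in W | nbr_in U w == p]|.+1) ^ M));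
    last first.
  by case: M @W UW => [//|M] W UW; rewrite leq_exp2r // prod_profiles_le.
rewrite -[#|W|]sum1_card (partition_big (nbr_in U) predT) //= expn_sum.
rewrite (big_morph (fun x => x ^ M)%N (fun x y => expnMn x y M) (exp1n M)).
apply: leq_prod => p _.
rewrite (_ : (\sum_(w in W | nbr_in U w == p) 1)%N =
    #|[set w in W | nbr_in U w == p]|); last first.
  by rewrite -sum1_card; apply: eq_bigl => w; rewrite inE.
apply: expn_swap.
have [->|/set0Pn[w]] := eqVneq [set w in W | nbr_in U w == p] set0; first by rewrite cards0.
rewrite inE => /andP[+ /eqP wp]; rewrite !inE => /andP[_ /andP[_]]; apply: leq_trans.
by apply/subset_leq_card/subsetP => z; rewrite !inE wp => /andP[].
Qed.

Lemma ln_ge1 (R : realType) (x : R) : 4 <= x -> 1 <= ln x.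
Proof.
move=> x4; have x0 : 0 < x by lra.
rewrite -[leLHS](expRK (R := R)) ler_ln ?posrE ?expR_gt0 //; apply: le_trans x4.
have h : 2^-1 <= expR (- 2^-1 : R) by have := expR_ge1Dx (- 2^-1 : R); lra.
have -> : 1 = 2^-1 + 2^-1 :> R by lra.
rewrite expRD; move: h; rewrite expRN -[2^-1 <= _]/(_ <= _) lef_pV2 ?posrE ?expR_gt0 // => h.
have := expR_gt0 (2^-1 : R); nra.
Qed.

(** Here u is the size of U, w the number of separated vertices outside U, and
    N the number of isomorphism classes.  Put l = ln d and r = n / d.  The
    hypothesis gives ln N >= (w / M) ln (M+1) - ln n - u l; the first term is at
    least K r l / 16 >= 37.5 r l, because M + 1 >= d / K >= sqrt d, and the
    other two are at most 2 r l and 33 r l. *)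
Lemma ln_num_induced_ge (R : realType) (K : R) (n d M u w N : nat) :
  (0 < n)%N -> (0 < M)%N -> 600 <= K -> K ^+ 2 <= d%:R -> d%:R <= n%:R :> R ->
  K * M%:R <= d%:R -> d%:R <= K * M.+1%:R ->
  d%:R * u%:R <= 33 * n%:R :> R -> n%:R <= 8 * w%:R :> R ->
  (M.+1 ^ w <= (N * (n * d ^ u)) ^ M)%N ->
  n%:R * ln d%:R / d%:R <= ln N%:R :> R.
Proof.
move=> n0 M0 K600 Kd dn Md dM du nw.
have K0 : 0 < K by lra.
have d4 : 4 <= d%:R :> R by apply: le_trans Kd; nra.
have d0 : 0 < d%:R :> R by lra.
have [->|N0] := posnP N.
  by rewrite mul0n exp0n // leqn0 expn_eq0.
rewrite -(ler_nat R) !natrX.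
have pos k : (0 < k)%N -> k%:R \is @Num.pos R by move=> k0; rewrite posrE ltr0n.
have d0' : (0 < d)%N by rewrite -(ltr_nat R).
have X0 : (0 < N * (n * d ^ u))%N by rewrite !muln_gt0 N0 n0 expn_gt0 d0'.
move=> Nle; have : ln (M.+1%:R ^+ w) <= ln ((N * (n * d ^ u))%:R ^+ M) :> R.
  by rewrite ler_ln ?posrE ?exprn_gt0 ?ltr0n.
rewrite !lnXn ?ltr0n //.
rewrite natrM lnM ?pos ?muln_gt0 ?n0 ?expn_gt0 ?d0' // natrM lnM ?pos ?expn_gt0 ?d0' //.
rewrite natrX lnXn //; set l := ln d%:R.
rewrite -[l *+ u]mulr_natl -[_ *+ w]mulr_natl -[_ *+ M]mulr_natl.
have l1 : 1 <= l by exact: ln_ge1.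
have lM : l <= 2 * ln M.+1%:R.
  have -> : 2 * ln M.+1%:R = ln (M.+1%:R ^+ 2) :> R.
    by rewrite lnXn ?ltr0n // mulr_natl.
  rewrite ler_ln ?posrE ?exprn_gt0 ?ltr0n // -(ler_pM2l (exprn_gt0 2 K0)) -exprMn.
  have : K ^+ 2 * d%:R <= d%:R ^+ 2 by rewrite expr2 ler_pM2r.
  by move=> /le_trans; apply; rewrite lerXn2r ?nnegrE ?mulr_ge0 // ltW.
pose r : R := n%:R / d%:R.
have nE : n%:R = r * d%:R by rewrite /r divfK ?gt_eqF.
have r1 : 1 <= r by rewrite /r ler_pdivlMr // mul1r.
have ln_n : ln n%:R <= 2 * (r * l).
  rewrite nE lnM ?posrE //; last by lra.
  have := ln_sublinear (lt_le_trans ltr01 r1).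
  have : 0 <= (r - 1) * (l - 1) by rewrite mulr_ge0 ?subr_ge0.
  rewrite -/l; nra.
have ur : u%:R <= 33 * r.
  by rewrite -(ler_pM2l d0); apply: le_trans du _; rewrite nE; lra.
have -> : n%:R * l / d%:R = r * l by rewrite /r mulrAC.
move=> main.
have M0' : 0 < M%:R :> R by rewrite ltr0n.
have wl : n%:R * l <= 16 * (w%:R * ln M.+1%:R).
  have : n%:R * l <= 8 * w%:R * l by rewrite ler_wpM2r //; lra.
  have : w%:R * l <= w%:R * (2 * ln M.+1%:R) by rewrite ler_wpM2l.
  lra.
set y := ln N%:R + _ in main.
have yle : y <= ln N%:R + (2 * (r * l) + 33 * r * l).
  by rewrite lerD2l lerD // ler_wpM2r //; lra.
have y_ge : K * (r * l) <= 16 * y.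
  rewrite -(ler_pM2l d0).
  have y0 : 0 <= y.
    rewrite -(ler_pM2l M0') mulr0; apply: le_trans _ main.
    by rewrite mulr_ge0 // ln_ge0 // ler1n.
  have KM : K * M%:R * y <= d%:R * y by rewrite ler_wpM2r.
  have rl : d%:R * (r * l) = n%:R * l by rewrite nE; ring.
  rewrite mulrCA rl; have := ler_wpM2l (ltW K0) main.
  have := ler_wpM2l (ltW K0) wl; lra.
have rl0 : 0 < r * l by rewrite mulr_gt0 //; lra.
have : 600 * (r * l) <= K * (r * l) by rewrite ler_wpM2r // ltW.
lra.
Qed.

Theorem theorem4 (R : realType) :
  exists delta1 delta2 delta3 : R,
    [/\ 0 < delta1, 0 < delta2 & 0 < delta3] /\
    forall (n d : nat) (lam : R) (G : sgraph),
      (0 < n)%N -> (0 < d)%N ->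
      ndl_graph n d lam G ->
      d%:R <= delta3 * n%:R ->
      lam / d%:R <= delta1 ->
      expR (delta2 * n%:R * ln d%:R / d%:R) <= (num_induced G)%:R.
Proof.
(* K is the ratio of d to the class size threshold M; any K >= 600 will do. *)
have [K K600] : exists K : R, 600 <= K by exists 600.
have K0 : 0 < K by lra.
exists (2 * K)^-1, 1, (40 * K)^-1; split.
  by split; rewrite // invr_gt0 mulr_gt0.
move=> n d lam G n0 d0 ndl dn lamd.
have d_gt0 : 0 < d%:R :> R by rewrite ltr0n.
have n_gt0 : 0 < n%:R :> R by rewrite ltr0n.
have [cG reg [s _ lamE]] := ndl.
pose L : R := d%:R / (2 * K).
have lamL : lam <= L by move: lamd; rewrite ler_pdivrMr // /L mulrC.
have lam0 : 0 <= lam by rewrite lamE le_max normr_ge0.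
have L0 : 0 < L by rewrite divr_gt0 // mulr_gt0.
have Ld : L <= d%:R / 20.
  by rewrite ler_pM2l // lef_pV2 ?posrE ?mulr_gt0 //; lra.
have lam_lt : lam < d%:R by lra.
have mix (S : {set G}) : (\sum_(v : G) #|nbr v :&: S|%:R ^+ 2) * #|G|%:R <=
    d%:R ^+ 2 * #|S|%:R ^+ 2 + L ^+ 2 * #|S|%:R * #|G|%:R.
  rewrite cG; apply: le_trans (nbr_second_moment S n0 ndl lam_lt) _.
  rewrite lerD2l !ler_wpM2r ?ler0n // lerXn2r ?nnegrE //; exact: ltW.
have dn' : 40 * K * d%:R <= n%:R.
  by move: dn; rewrite mulrC ler_pdivlMr ?mulr_gt0 // mulrC.
have LKE : L ^+ 2 * (4 * K ^+ 2) = d%:R ^+ 2 by rewrite /L; field; rewrite gt_eqF.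
have LK : 40 * K * L ^+ 2 <= d%:R ^+ 2.
  by rewrite -LKE mulrC ler_wpM2l ?sqr_ge0 //; nra.
have d_le_n : d%:R <= n%:R / 2 :> R.
  have : 2 * d%:R <= 40 * K * d%:R by rewrite ler_wpM2r //; lra.
  lra.
have d_large : K ^+ 2 <= d%:R.
  (* For a single vertex the second moment is d, whence d <= d^2 / n + L^2. *)
  have /card_gt0P[v _] : (0 < #|G|)%N by rewrite cG.
  have := mix [set v]; rewrite cards1 !mulr1 expr1n mulr1 cG.
  have -> : \sum_(x : G) #|nbr x :&: [set v]|%:R ^+ 2 = d%:R :> R.
    transitivity (\sum_(x : G) #|nbr x :&: [set v]|%:R : R).
      apply: eq_bigr => x _; have : (#|nbr x :&: [set v]| <= 1)%N.
        by rewrite -(cards1 v) subset_leq_card // subsetIr.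
      by case: #|_| => [|[|]] //; rewrite ?expr0n ?expr1n.
    by rewrite -natr_sum (regular_sum_nbr _ reg) cards1 muln1.
  have K2 : 0 < 4 * K ^+ 2 by rewrite mulr_gt0 ?exprn_gt0.
  rewrite -(ler_pM2l K2).
  have -> : 4 * K ^+ 2 * (d%:R ^+ 2 + L ^+ 2 * n%:R) =
      d%:R * (4 * K ^+ 2 * d%:R + d%:R * n%:R).
    by rewrite mulrDr mulrA [4 * _ * L ^+ 2]mulrC LKE; ring.
  rewrite mulrCA ler_pM2l // => nle; rewrite -(ler_pM2r n_gt0).
  have := ler_wpM2l (ltW K2) d_le_n.
  have : 0 <= K ^+ 2 * n%:R by rewrite mulr_ge0 ?sqr_ge0.
  lra.
have [M Md dM] : exists2 M : nat, K * M%:R <= d%:R & d%:R <= K * M.+1%:R.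
  exists (Num.truncn (d%:R / K)).
    by rewrite mulrC -ler_pdivlMr // truncn_le // divr_ge0 // ltW.
  by rewrite mulrC -ler_pdivrMr // ltW // truncnS_gt.
have M0 : (0 < M)%N.
  rewrite lt0n; apply/eqP => M0; move: dM; rewrite M0 mulr1 => dM.
  have : K * 600 <= K ^+ 2 by rewrite expr2 ler_pM2l.
  lra.
have nG : #|G|%:R = n%:R :> R by rewrite cG.
have n0' : (0 < #|G|)%N by rewrite cG.
have [| U [homU sU gU]] := separating_set reg L0 n0' mix (M := M) K0 Ld _ LK dM.
  by rewrite nG.
rewrite mul1r.
have large := exp_separated_le U M.
have N0 : (0 < num_induced G)%N.
  rewrite lt0n; apply/eqP => N0; move: large.
  by rewrite N0 mul0n exp0n // leqn0 expn_eq0.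
rewrite -[leRHS]lnK ?posrE ?ltr0n // ler_expR.
apply: (ln_num_induced_ge (K := K) (M := M) (u := #|U|) (w := #|separated M U :\: U|)) => //.
- lra.
- by rewrite nG in sU; lra.
- have : #|separated M U|%:R <= #|U|%:R + #|separated M U :\: U|%:R :> R.
    rewrite -natrD ler_nat -(cardsID U (separated M U)) leq_add2r.
    by rewrite subset_leq_card // subsetIr.
  have : 600 * #|U|%:R <= d%:R * #|U|%:R :> R.
    by rewrite ler_wpM2r // (le_trans _ d_large) // expr2; nra.
  rewrite nG in sU gU; lra.
- apply: leq_trans large _.
  case: (M) M0 => // M' _; rewrite leq_exp2r // leq_mul2l -cG.
  by rewrite homU orbT.
Qed.
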